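(* There is a sequence of real numbers $(\delta_k)_{k\ge1}$ with $\delta_k\to0$ such that, for all $k$, $$\log\epsilon_k^{inv}\le 2^k\log(C+\delta_k),$$ where $\epsilon_k^{inv}$ and $C$ are as in the context.
   Context: For a positive integer $n$, $\Phi_n(x)=\prod_{1\le j\le n,\ (j,n)=1}(x-e^{2\pi i j/n})=\sum_{m}a_n(m)x^m$ is the $n$-th cyclotomic polynomial, $A_n=\max_m|a_n(m)|$, $S_n=\sum_m|a_n(m)|$. Write $\Psi_n(x)=1/\Phi_n(x)=\sum_{m\ge0}c_n(m)x^m$ as a formal power series and $C_n=\max_m|c_n(m)|$. For distinct odd primes $p_1<\dots<p_k$ put $M_k=\prod_{i=1}^{k-2}p_i^{2^{k-i-1}-1}$. $\epsilon_k$ is the smallest positive real with $A_{p_1\cdots p_k}\le\epsilon_kM_k$ for all odd primes $p_1<\dots<p_k$, and $\epsilon_k^{inv}$ is the smallest positive real with $C_{p_1\cdots p_k}\le\epsilon_k^{inv}M_k$ for all odd primes $p_1<\dots<p_k$. Let $d=\sup_{p<q<r\text{ odd primes}}S_{pqr}/(p^2qr)$, $\rho=\prod_{i=0}^{\infty}\big(\frac{2i+5}{2i+6}\big)^{1/2^i}$ and $C=\big(\tfrac34\epsilon_3^{3/2}d\rho^{1/4}\big)^{1/32}$. *)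

(* Defs.v *)
From Stdlib Require Import Reals ClassicalEpsilon.
From HB Require Import structures.
From mathcomp Require Import all_boot all_order all_algebra all_field.
Set Implicit Arguments. Unset Strict Implicit. Unset Printing Implicit Defensive.
Import GRing.Theory.

Local Open Scope ring_scope.

Definition acoef (n m : nat) : int := ('Phi_n)`_m.

(* Psi_n = 1/Phi_n as a formal power series.  Phi_n(0) = a_n(0) is +-1, so
   its inverse is itself, and the coefficients c_n(m) are determined by
   c_n(0) = a_n(0)^{-1},  c_n(m) = -a_n(0)^{-1} * sum_{i=1}^m a_n(i) c_n(m-i).
   psi_seq n m = [:: c_n(0); ...; c_n(m)]. *)
Fixpoint psi_seq (n m : nat) : seq int :=
  match m with
  | 0%N => [:: acoef n 0]
  | m'.+1 =>
      let s := psi_seq n m' in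
      rcons s (acoef n 0 * - (\sum_(1 <= i < m.+1) acoef n i * nth 0 s (m - i)%N))
  end.

Definition ccoef (n m : nat) : int := nth 0 (psi_seq n m) m.

Definition An (n : nat) : nat := \max_(m < size ('Phi_n)) `|acoef n m|%N.
Definition Sn (n : nat) : nat := \sum_(m < size ('Phi_n)) `|acoef n m|%N.

Local Close Scope ring_scope.

Definition odd_prime_tuple (k : nat) (l : seq nat) : bool :=
  [&& size l == k, sorted ltn l & all (fun p => prime p && odd p) l].

Definition prodl (l : seq nat) : nat := \prod_(p <- l) p.

(* M_k = prod_{i=1}^{k-2} p_i^(2^(k-i-1)-1); with 0-based index j = i-1 *)
Definition Mk (k : nat) (l : seq nat) : nat :=
  \prod_(j < k - 2) (nth 0 l j) ^ (2 ^ (k - j - 2) - 1).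

Open Scope R_scope.

(* the least element of a set of reals (junk value 0 if none exists) *)
Definition Rleast (P : R -> Prop) : R :=
  match excluded_middle_informative (exists e, P e /\ forall e', P e' -> e <= e') with
  | left H => proj1_sig (constructive_indefinite_description _ H)
  | right _ => 0
  end.

(* the supremum of a set of reals (junk value 0 if it does not exist) *)
Definition Rsup (P : R -> Prop) : R :=
  match excluded_middle_informative (exists l, is_lub P l) with
  | left H => proj1_sig (constructive_indefinite_description _ H)
  | right _ => 0
  end.

(* the limit of a real sequence (junk value 0 if it does not converge) *)
Definition Rlim (u : nat -> R) : R :=
  match excluded_middle_informative (exists l, Un_cv u l) with
  | left H => proj1_sig (constructive_indefinite_description _ H)
  | right _ => 0
  end.

Definition Cn (n : nat) : R := Rsup (fun x => exists m : nat, x = INR `|ccoef n m|%N).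

Definition eps (k : nat) : R :=
  Rleast (fun e => 0 < e /\ forall l, odd_prime_tuple k l ->
            INR (An (prodl l)) <= e * INR (Mk k l)).

Definition eps_inv (k : nat) : R :=
  Rleast (fun e => 0 < e /\ forall l, odd_prime_tuple k l ->
            Cn (prodl l) <= e * INR (Mk k l)).

Definition dconst : R :=
  Rsup (fun x => exists p q r : nat,
          odd_prime_tuple 3 [:: p; q; r] /\
          x = INR (Sn (p * q * r)) / (INR p ^ 2 * INR q * INR r)).

Definition rho_partial (N : nat) : R :=
  \big[Rmult/1]_(i < N.+1)
     Rpower ((2 * INR i + 5) / (2 * INR i + 6)) (/ 2 ^ i).

Definition rho : R := Rlim rho_partial.

Definition Cconst : R :=
  Rpower (3 / 4 * Rpower (eps 3) (3 / 2) * dconst * Rpower rho (/ 4)) (/ 32).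

(* Main.v *)
Require Import Defs.
From Stdlib Require Import Reals Lra ClassicalEpsilon.
From HB Require Import structures.
From mathcomp Require Import all_boot all_order all_algebra all_field.
From mathcomp Require Import zify ring.
Set Implicit Arguments. Unset Strict Implicit. Unset Printing Implicit Defensive.
Import GRing.Theory.

(** Write [n = p_1 ... p_k], [n_j = p_1 ... p_j], and let [L_n] be the sum of the
    absolute values of the coefficients of [(X^n - 1) / Phi_n], one period of
    [1 / Phi_n].  For a prime [p] not dividing [m],
    [(X^m - 1) Phi_{mp} = Phi_m(X^p) (X^m - 1) / Phi_m].  In a residue class
    mod [m] the coefficients of the left-hand side telescope to any coefficient
    of [Phi_{mp}] both from below and from above, which gains a factor 2:
    [2 A_{mp} <= A_m L_m].  Moreover [C_{mp} <= A_m L_m] and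
    [L_{mp} <= S_m L_m], so that [A_{n_k} <= A_{n_{k-1}} S_{n_1} ... S_{n_{k-2}}],
    and twice this bounds [C_{n_k}].  Feeding in [S_p <= p], [S_{pq} <= pq / 2],
    [S_{pqr} <= d p^2 q r], [S_n <= n A_n] and [M_{k+2} = M_{k+1}^2 n_k] gives
    [epsilon_k^inv <= 2 (epsilon_3 d / 4)^(2^(k-5))] for [k >= 6].  As
    [epsilon_3 >= 1/3], this is already at most [C^(2^k)], so [delta_k = 0] for
    [k >= 6]. *)

(** * Weighted coefficient sums of integer polynomials *)

Local Open Scope ring_scope.

Lemma abszD_le (a b : int) : (`|(a + b)%R| <= `|a| + `|b|)%N.
Proof. lia. Qed.

(** The predicate selects indices, later a residue class. Keeping it general lets a shift by ['X^j]
    or a substitution of ['X^p] be recorded in [w] alone. *)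
Definition wnorm (w : pred nat) (P : {poly int}) : nat :=
  \sum_(i < size P | w i) `|(P`_i)%R|%N.

Notation norm1 := (wnorm predT).

Lemma wnormE w (P : {poly int}) N : (size P <= N)%N ->
  wnorm w P = (\sum_(0 <= i < N | w i) `|(P`_i)%R|)%N.
Proof.
move=> hN; rewrite (@big_cat_nat _ _ _ (size P)) //= /wnorm -(big_mkord w (fun i => `|(P`_i)%R|%N)).
rewrite [X in _ = (_ + X)%N]big_nat_cond [X in _ = (_ + X)%N]big1 ?addn0 //.
by move=> i /andP[/andP[hi _] _]; rewrite nth_default.
Qed.

Lemma wnormD w (P Q : {poly int}) : (wnorm w (P + Q) <= wnorm w P + wnorm w Q)%N.
Proof.
set N := maxn (size P) (size Q).
rewrite (@wnormE w _ N) ?size_polyD // (@wnormE w P N) ?leq_maxl //.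
rewrite (@wnormE w Q N) ?leq_maxr // -big_split /=.
by apply: leq_sum => i _; rewrite coefD abszD_le.
Qed.

Lemma wnorm_sum (I : Type) (r : seq I) (F : I -> {poly int}) w :
  (wnorm w (\sum_(i <- r) F i) <= \sum_(i <- r) wnorm w (F i))%N.
Proof.
elim: r => [|a r IH]; first by rewrite !big_nil /wnorm size_poly0 big_ord0.
by rewrite !big_cons (leq_trans (wnormD _ _ _)) // leq_add2l.
Qed.

Lemma size_XnM_leq n (P : {poly int}) : (size ('X^n * P)%R <= n + size P)%N.
Proof. by rewrite (leq_trans (size_polyMleq _ _)) // size_polyXn. Qed.

Lemma wnormZXM w c j (P : {poly int}) :
  (wnorm w (c *: 'X^j * P) <= `|c| * wnorm (fun i => w (j + i)) P)%N.
Proof.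
have hs : (size (c *: 'X^j * P)%R <= j + size P)%N.
  by rewrite -scalerAl (leq_trans (size_scale_leq _ _)) // size_XnM_leq.
rewrite (wnormE w hs) (@wnormE _ P (size P)) // (@big_cat_nat _ _ _ j) ?leq_addr //=.
rewrite [X in (X + _)%N]big_nat_cond [X in (X + _)%N]big1 ?add0n; last first.
  by move=> i /andP[/andP[_ hi] _]; rewrite -scalerAl coefZ coefXnM hi mulr0.
rewrite -{1}[j]addn0 addnC (addnC j) big_addn addnK big_distrr /=.
rewrite (eq_bigl (fun i => w (j + i)%N)); last by move=> i; rewrite addnC.
by apply: leq_sum => i _; rewrite -scalerAl coefZ coefXnM ltnNge leq_addl /= addnK abszM.
Qed.

(** Expand [P] into monomials: the factor ['X^j] shifts the selected index set by [j]. *)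
Lemma wnormM w (P Q : {poly int}) :
  (wnorm w (P * Q) <= \sum_(j < size P) `|(P`_j)%R| * wnorm (fun i => w (j + i)) Q)%N.
Proof.
rewrite -{1}[P]coefK poly_def mulr_suml (leq_trans (wnorm_sum _ _ _)) //.
by apply: leq_sum => j _; apply: wnormZXM.
Qed.

Lemma norm1M (P Q : {poly int}) : (norm1 (P * Q) <= norm1 P * norm1 Q)%N.
Proof. by rewrite (leq_trans (wnormM _ _ _)) // big_distrl. Qed.

Lemma wnorm_comp w (P : {poly int}) p :
  (wnorm w (P \Po 'X^p) <= wnorm (fun i => w (p * i)) P)%N.
Proof.
rewrite comp_polyE (leq_trans (wnorm_sum _ _ _)) // /wnorm [X in (_ <= X)%N]big_mkcond /=.
apply: leq_sum => i _; rewrite -exprM -[_ *: _]mulr1.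
rewrite (leq_trans (wnormZXM _ _ _ _)) // /wnorm size_poly1 big_mkcond big_ord1 /= addn0.
by rewrite coef1; case: ifP => //=; rewrite ?muln0 ?muln1.
Qed.

Lemma norm1_comp (P : {poly int}) p : (norm1 (P \Po 'X^p) <= norm1 P)%N.
Proof. exact: wnorm_comp. Qed.

Lemma norm1XnM (P : {poly int}) n : norm1 ('X^n * P) = norm1 P.
Proof.
rewrite (wnormE _ (size_XnM_leq n P)) (@wnormE _ P (size P)) // (@big_cat_nat _ _ _ n) ?leq_addr //=.
rewrite [X in (X + _)%N]big_nat_cond [X in (X + _)%N]big1 ?add0n; last first.
  by move=> i /andP[/andP[_ hi] _]; rewrite coefXnM hi.
rewrite -{1}[n]addn0 addnC (addnC n) big_addn addnK.
by apply: eq_bigr => i _; rewrite coefXnM ltnNge leq_addl /= addnK.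
Qed.

Lemma height_mul (P Q : {poly int}) A t : (forall i, `|(P`_i)%R| <= A)%N ->
  (`|((P * Q)`_t)%R| <= A * norm1 Q)%N.
Proof.
move=> hA; rewrite -{1}[Q]coefK poly_def mulr_sumr coef_sum /wnorm.
elim/big_ind2: _ => [|x1 x2 y1 y2 h1 h2|i _]; first by [].
  by rewrite mulnDr (leq_trans (abszD_le _ _)) ?leq_add.
rewrite -scalerAr coefZ coefMXn abszM mulnC leq_mul //.
by case: ifP.
Qed.

(** * Cyclotomic polynomials *)

Lemma divisors_mul_prime m p : (0 < m)%N -> prime p -> ~~ (p %| m)%N ->
  perm_eq (divisors (m * p)) (divisors m ++ [seq (d * p)%N | d <- divisors m]).
Proof.
move=> m0 pp pm; have p0 := prime_gt0 pp.
apply: uniq_perm; first exact: divisors_uniq.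
  rewrite cat_uniq divisors_uniq map_inj_uniq ?divisors_uniq ?andbT /=; last first.
    by move=> a b /eqP; rewrite eqn_pmul2r // => /eqP.
  apply/hasPn => _ /mapP[d _ ->]; rewrite -dvdn_divisors //.
  by apply: contra pm; apply: dvdn_trans; apply: dvdn_mull.
move=> d; rewrite mem_cat -!dvdn_divisors ?muln_gt0 ?m0 ?p0 //.
apply/idP/orP => [dmp|[dm|/mapP[e]]].
- case: (boolP (p %| d)%N) => [/dvdnP[e ed]|pd].
    right; apply/mapP; exists e => //.
    by move: dmp; rewrite ed dvdn_pmul2r // -dvdn_divisors.
  by left; rewrite -(@Gauss_dvdl _ _ p) // coprime_sym prime_coprime.
- exact: dvdn_mulr.
- by rewrite -dvdn_divisors // => em ->; rewrite dvdn_pmul2r.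
Qed.

(** Strong induction on [m]: over all divisors [d] of [m], both sides multiply to ['X^(m * p) - 1],
    and the induction hypothesis cancels the factors with [d < m]. *)
Lemma Phi_mul_prime m p : (0 < m)%N -> prime p -> ~~ (p %| m)%N ->
  'Phi_(m * p) * 'Phi_m = 'Phi_m \Po 'X^p.
Proof.
move=> + pp; elim/ltn_ind: m => m IH m0 pm; have p0 := prime_gt0 pp.
have mdiv : m \in divisors m by rewrite -dvdn_divisors.
have key : \prod_(d <- divisors m) ('Phi_(d * p) * 'Phi_d) =
           \prod_(d <- divisors m) ('Phi_d \Po 'X^p).
  transitivity ('X^(m * p) - 1 : {poly int}).
    rewrite -prod_Cyclotomic ?muln_gt0 ?m0 //.
    by rewrite (perm_big _ (divisors_mul_prime m0 pp pm)) big_cat big_map big_split /= mulrC.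
  rewrite -(rmorph_prod (comp_poly 'X^p)) prod_Cyclotomic //.
  by rewrite rmorphB rmorph1 rmorphXn /= comp_polyX -exprM mulnC.
move: key; rewrite !(big_rem m mdiv) /=.
rewrite (@eq_big_seq _ _ _ _ _ (fun d => 'Phi_d \Po 'X^p) (fun d => 'Phi_(d * p) * 'Phi_d)).
  apply: mulIf; apply: monic_neq0; rewrite monic_prod // => d _.
  by rewrite monicMl Cyclotomic_monic.
move=> d; rewrite mem_rem_uniq ?divisors_uniq // inE -dvdn_divisors // => /andP[dm ddm].
rewrite IH ?(dvdn_gt0 m0 ddm) //; first by rewrite ltn_neqAle dm dvdn_leq.
by apply: contra pm => pd; apply: dvdn_trans ddm.
Qed.

(* (X^n - 1) / Phi_n, whose coefficients up to sign are one period of those of 1 / Phi_n *)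
Definition coPhi n : {poly int} := \prod_(d <- rem n (divisors n)) 'Phi_d.

Lemma mul_coPhi n : (0 < n)%N -> 'Phi_n * coPhi n = 'X^n - 1.
Proof.
by move=> n0; rewrite -prod_Cyclotomic // (big_rem n) //= -dvdn_divisors.
Qed.

Lemma Phi_neq0 n : 'Phi_n != 0 :> {poly int}.
Proof. exact/monic_neq0/Cyclotomic_monic. Qed.

(** Multiplied by ['Phi_(m * p)], both sides become ['X^(m * p) - 1]; on the right this is
    [mul_coPhi] for [m] evaluated at ['X^p]. *)
Lemma coPhi_mul_prime m p : (0 < m)%N -> prime p -> ~~ (p %| m)%N ->
  coPhi (m * p) = 'Phi_m * (coPhi m \Po 'X^p).
Proof.
move=> m0 pp pm; apply: (mulfI (Phi_neq0 (m * p))).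
rewrite mul_coPhi ?muln_gt0 ?m0 ?prime_gt0 // mulrA Phi_mul_prime // -comp_polyM mul_coPhi //.
by rewrite rmorphB rmorph1 rmorphXn /= comp_polyX -exprM mulnC.
Qed.

Lemma totient_lt n : (1 < n)%N -> (totient n < n)%N.
Proof.
move=> n1; rewrite totient_count_coprime big_ltn ?(ltnW n1) //.
rewrite /coprime gcdn0 gtn_eqF // add0n.
apply: (@leq_ltn_trans (\sum_(1 <= d < n) 1)%N); first by apply: leq_sum => d _; case: (_ == _).
by rewrite sum_nat_const_nat muln1; lia.
Qed.

Lemma size_Phi_leq n : (1 < n)%N -> (size 'Phi_n <= n)%N.
Proof. by move=> n1; rewrite size_Cyclotomic totient_lt. Qed.

(** The degree is [n - totient n], so all coefficients fit into one period of length [n]. *)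
Lemma size_coPhi n : (0 < n)%N -> (size (coPhi n) <= n)%N.
Proof.
move=> n0; have h := mul_coPhi n0.
have c0 : coPhi n != 0.
  apply: contra_eq_neq h => ->; rewrite mulr0 eq_sym -size_poly_eq0 size_XnsubC //.
have := congr1 (fun q : {poly int} => size q) h.
rewrite size_monicM ?Cyclotomic_monic // size_XnsubC // size_Cyclotomic.
by have := totient_gt0 n; rewrite n0 => /=; lia.
Qed.

Lemma An_ge n i : (`|(('Phi_n)`_i)%R| <= An n)%N.
Proof.
case: (ltnP i (size 'Phi_n)) => hi; last by rewrite nth_default.
by rewrite /An (@bigmax_sup _ (Ordinal hi)).
Qed.

Lemma SnE n : Sn n = norm1 'Phi_n. Proof. by []. Qed.

Definition Ln n := norm1 (coPhi n).

Lemma Ln_mul_prime m p : (0 < m)%N -> prime p -> ~~ (p %| m)%N ->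
  (Ln (m * p) <= Sn m * Ln m)%N.
Proof.
move=> m0 pp pm; rewrite /Ln coPhi_mul_prime // SnE.
by rewrite (leq_trans (norm1M _ _)) // leq_mul2l norm1_comp orbT.
Qed.

Lemma coPhi_coef_mul_prime m p t : (0 < m)%N -> prime p -> ~~ (p %| m)%N ->
  (`|((coPhi (m * p))`_t)%R| <= An m * Ln m)%N.
Proof.
move=> m0 pp pm; rewrite coPhi_mul_prime //.
rewrite (leq_trans (height_mul _ _ (An_ge m))) //.
by rewrite leq_mul2l norm1_comp orbT.
Qed.

Lemma Sn_leq n : (1 < n)%N -> (Sn n <= n * An n)%N.
Proof.
move=> n1; apply: (@leq_trans (\sum_(i < size 'Phi_n) An n)%N).
  by apply: leq_sum => i _; apply: An_ge.
by rewrite sum_nat_const card_ord leq_mul2r size_Phi_leq ?orbT.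
Qed.

(** At most one coefficient survives the selection, so the sum is bounded by the height. *)
Lemma wnorm_uniq (w : pred nat) n : (forall i j, (i < size 'Phi_n)%N -> (j < size 'Phi_n)%N ->
    w i -> w j -> i = j) -> (wnorm w 'Phi_n <= An n)%N.
Proof.
move=> hw; rewrite /wnorm.
case: (pickP [pred i : 'I_(size 'Phi_n) | w i]) => [i /= wi|no]; last first.
  by rewrite big1 // => i wi; have := no i; rewrite /= wi.
rewrite (bigD1 i) //= big1 ?addn0 ?An_ge // => j /andP[wj /eqP[]].
exact/val_inj/(hw _ _ (ltn_ord j) (ltn_ord i) wj wi).
Qed.

(* The sum of the coefficients of [('X^m - 1) * Q] over a residue class mod m
   telescopes to [- Q`_t] up to the index t and to [Q`_t] beyond it. *)
Lemma wnorm_XnB1 (Q : {poly int}) m t : (0 < m)%N ->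
  (2 * `|(Q`_t)%R| <= wnorm (fun s => s %% m == t %% m)%N (('X^m - 1) * Q))%N.
Proof.
move=> m0; set w := fun s => _; set G := (_ * Q); set r := (t %% m)%N.
have rm : (r < m)%N by rewrite ltn_mod.
(* [V] is so large that [m * V] exceeds the size of [G], that [b V.-1] lies beyond the degree of
   [Q], and that the index [t] is passed. *)
pose V := (size Q + size G + t).+2; pose b v := Q`_(r + m * v).
have Gb v : G`_(r + m * v.+1) = b v - b v.+1.
  rewrite /G mulrBl mul1r coefB coefXnM ifF; last by lia.
  by congr (Q`_ _ - _); lia.
have G0 : G`_(r + m * 0) = - b 0%N.
  by rewrite /G mulrBl mul1r coefB coefXnM ifT ?sub0r //; rewrite muln0 addn0 ltn_mod.
have tele u : \sum_(0 <= v < u.+1) G`_(r + m * v) = - b u.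
  elim: u => [|u IH]; first by rewrite big_nat1 G0.
  by rewrite big_nat_recr //= IH Gb addrA addNr add0r.
(* The block of indices from [m * u] to [m * u.+1] contains the class member [r + m * u]; its term
   alone is kept. *)
have sumG u :
    (\sum_(0 <= v < u) `|(G`_(r + m * v))%R| <= \sum_(0 <= s < m * u | w s) `|(G`_s)%R|)%N.
  elim: u => [|u IH]; first by rewrite big_geq.
  rewrite big_nat_recr //= (@big_cat_nat _ _ _ (m * u) 0%N (m * u.+1)%N) ?leq_mul2l ?leqnSn ?orbT //=.
  rewrite leq_add // big_mkcond /= (@big_cat_nat _ _ _ (r + m * u)) ?leq_addl /= //; last first.
    by rewrite mulnS leq_add2r ltnW.
  rewrite (@big_ltn _ _ _ (r + m * u)) ?mulnS ?ltn_add2r //.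
  rewrite /w addnC mulnC modnMDl modn_mod eqxx addnCA leq_addr //.
have hV : (size G <= m * V)%N by rewrite /V; nia.
rewrite (wnormE _ hV) (leq_trans _ (sumG V)) //.
have bt : Q`_t = b (t %/ m)%N by rewrite /b /r addnC mulnC -divn_eq.
have uV : ((t %/ m).+1 <= V.-1.+1)%N by have := leq_div t m; rewrite /V; lia.
have V0 : V = V.-1.+1 by rewrite /V; lia.
have nsum (s : seq nat) (F : nat -> int) :
    (`|(\sum_(v <- s) F v)%R| <= \sum_(v <- s) `|F v|)%N.
  elim/big_rec2: _ => // v y x _ h; apply: leq_trans (abszD_le _ _) _; lia.
have := tele V.-1; rewrite (@big_cat_nat _ _ _ (t %/ m).+1) // tele /=.
have -> : b V.-1 = 0.
  rewrite /b nth_default // (leq_trans _ (leq_addl _ _)) //.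
  by rewrite (leq_trans _ (leq_pmull _ m0)) // /V /= leqW // -addnA leq_addr.
move/eqP; rewrite oppr0 addrC subr_eq0 => /eqP e2.
rewrite V0 (@big_cat_nat _ _ _ (t %/ m).+1) // mul2n -addnn leq_add //.
  by rewrite (leq_trans _ (nsum _ _)) // tele -bt abszN.
by rewrite (leq_trans _ (nsum _ _)) // e2 bt.
Qed.

(** Apply [wnorm_XnB1] to ['Phi_(m * p)]. For each index [j] of [coPhi m], the condition that
    [j + p * i] be congruent to [t] mod [m] fixes [i] mod [m], so at most one coefficient of
    ['Phi_m] meets it. *)
Lemma An_mul_prime m p : (1 < m)%N -> prime p -> ~~ (p %| m)%N ->
  (2 * An (m * p) <= An m * Ln m)%N.
Proof.
move=> m1 pp pm; have m0 := ltnW m1.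
have H t : (2 * `|(('Phi_(m * p))`_t)%R| <= An m * Ln m)%N.
  apply: leq_trans (wnorm_XnB1 _ t m0) _.
  have -> : ('X^m - 1) * 'Phi_(m * p) = coPhi m * ('Phi_m \Po 'X^p).
    by rewrite -(mul_coPhi m0) -(Phi_mul_prime m0 pp pm); ring.
  rewrite (leq_trans (wnormM _ _ _)) // /Ln [X in (_ * X)%N]/wnorm big_distrr /=.
  apply: leq_sum => j _; rewrite mulnC leq_mul2r; apply/orP; right.
  rewrite (leq_trans (wnorm_comp _ _ _)) // wnorm_uniq // => a c ha hc /eqP <- /eqP.
  have sm := size_Phi_leq m1.
  move/eqP; rewrite eqn_modDl.
  wlog ac : a c ha hc / (a <= c)%N => [W|].
    by case/orP: (leq_total a c) => [/W|h e]; [exact|apply/esym/W => //; rewrite eq_sym].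
  (* [m] divides [p * (c - a)], hence [c - a], which is below [size 'Phi_m <= m] and so is zero. *)
  rewrite eqn_mod_dvd ?leq_mul2l ?ac ?orbT // -mulnBr Gauss_dvdr; last first.
    by rewrite coprime_sym prime_coprime.
  move=> /dvdnP[[|k]]; nia.
have [t ->] : exists t, An (m * p) = `|(('Phi_(m * p))`_t)%R|%N.
  have [] := @eq_bigmax _ (fun i : 'I_(size 'Phi_(m * p)) => `|acoef (m * p) i|%N).
    by rewrite card_ord size_Cyclotomic.
  by move=> i e; exists i.
exact: H.
Qed.

(** * Explicit bounds for a prime and for a product of two primes *)

Lemma Phi1 : 'Phi_1 = 'X - 1 :> {poly int}.
Proof. by rewrite -(expr1 'X) -prod_Cyclotomic //= big_seq1. Qed.

Lemma Phi_prime_mul p : prime p -> 'Phi_p * ('X - 1) = 'X^p - 1 :> {poly int}.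
Proof.
move=> pp; rewrite -Phi1 -{1}[p]mul1n Phi_mul_prime // ?Phi1; last first.
  by rewrite dvdn1 neq_ltn prime_gt1 ?orbT.
by rewrite rmorphB rmorph1 /= comp_polyX.
Qed.

Lemma An_prime p : prime p -> (An p <= 1)%N.
Proof.
move=> pp; rewrite /An; apply/bigmax_leqP => i _; rewrite /acoef; move: (nat_of_ord i) => {}i.
have -> : 'Phi_p = \poly_(j < p) 1.
  apply: (mulIf (monic_neq0 (monicXsubC 1))).
  rewrite Phi_prime_mul // subrX1 mulrC poly_def; congr (_ * _).
  by apply: eq_bigr => j _; rewrite scale1r.
by rewrite coef_poly; case: ifP.
Qed.

Lemma Sn_prime p : prime p -> (Sn p <= p)%N.
Proof.
move=> pp; apply: leq_trans (Sn_leq (prime_gt1 pp)) _.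
by rewrite -[X in (_ <= X)%N]muln1 leq_mul2l An_prime ?orbT.
Qed.

Lemma norm1N (P : {poly int}) : norm1 (- P) = norm1 P.
Proof.
by rewrite /wnorm size_polyN; apply: eq_bigr => i _; rewrite coefN abszN.
Qed.

Lemma norm1Xn n : norm1 'X^n = 1%N.
Proof. by rewrite -[ 'X^n]mulr1 norm1XnM /wnorm size_poly1 big_ord1 coef1. Qed.

Lemma Ln1 : Ln 1 = 1%N.
Proof. by rewrite /Ln /coPhi big_nil /wnorm size_poly1 big_ord1 coef1. Qed.

Lemma Ln_prime p : prime p -> (Ln p <= 2)%N.
Proof.
move=> pp; rewrite -{1}[p]mul1n.
have p1 : ~~ (p %| 1)%N by rewrite dvdn1 neq_ltn prime_gt1 ?orbT.
apply: (leq_trans (Ln_mul_prime _ pp p1)) => //.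
rewrite Ln1 muln1 SnE Phi1 (leq_trans (wnormD _ _ _)) // norm1N -['X]expr1 norm1Xn.
by rewrite -[X in wnorm _ X](expr0 'X) norm1Xn.
Qed.

Lemma norm1_geom (m n : nat) : (norm1 (\sum_(i < n) 'X^m ^+ i) <= n)%N.
Proof.
rewrite (leq_trans (wnorm_sum _ _ _)) // (eq_bigr (fun=> 1%N)); last first.
  by move=> i _; rewrite -exprM norm1Xn.
by rewrite sum1_card card_ord.
Qed.

Lemma Phi_mul_primes_mul p q : prime p -> prime q -> p != q ->
  'Phi_(p * q) * (('X^p - 1) * ('X^q - 1)) = ('X - 1) * ('X^(p * q) - 1) :> {poly int}.
Proof.
move=> pp pq npq; have qp : ~~ (q %| p)%N by rewrite dvdn_prime2 // eq_sym.
have e : ('Phi_p \Po 'X^q) * ('X^q - 1) = 'X^(p * q) - 1.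
  have := congr1 (comp_poly 'X^q) (Phi_prime_mul pp).
  by rewrite comp_polyM !rmorphB !rmorph1 rmorphXn /= !comp_polyX -exprM mulnC.
rewrite -e -(Phi_mul_prime (prime_gt0 pp) pq qp) -(Phi_prime_mul pp); ring.
Qed.

(** The classical splitting of ['Phi_(p * q)], with [a] inverse to [p] mod [q] and [b] inverse to
    [q] mod [p]. Multiplying by [('X^p - 1) * ('X^q - 1)] collapses the geometric sums. The factor
    ['X^1] is kept as a power so that [norm1XnM] applies. *)
Lemma Phi_mul_primes p q a b : prime p -> prime q -> p != q ->
    (a <= q)%N -> (b <= p)%N -> (a * p + b * q = p * q + 1)%N ->
  'Phi_(p * q) = (\sum_(i < a) 'X^p ^+ i) * (\sum_(j < b) 'X^q ^+ j)
    - 'X^1 * ((\sum_(i < q - a) 'X^p ^+ i) * (\sum_(j < p - b) 'X^q ^+ j)) :> {poly int}.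
Proof.
move=> pp pq npq aq bp eab.
have Xn_neq1 n : prime n -> 'X^n - 1 != 0 :> {poly int}.
  by move=> pn; apply/monic_neq0/monicXnsubC/prime_gt0.
apply: (mulIf (mulf_neq0 (Xn_neq1 _ pp) (Xn_neq1 _ pq))).
rewrite Phi_mul_primes_mul //.
have geom m n : ('X^m - 1) * (\sum_(i < n) 'X^m ^+ i) = 'X^(m * n) - 1 :> {poly int}.
  by rewrite -subrX1 exprM.
have [[[gA gB] gA'] gB'] := (geom p a, geom q b, geom p (q - a)%N, geom q (p - b)%N).
set A := \sum_(i < a) _ in gA *; set B := \sum_(i < b) _ in gB *.
set A' := \sum_(i < _) _ in gA' *; set B' := \sum_(i < p - b) _ in gB' *.
transitivity ((('X^p - 1) * A) * (('X^q - 1) * B)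
  - 'X * ((('X^p - 1) * A') * (('X^q - 1) * B')) : {poly int}); last by ring.
rewrite gA gB gA' gB'.
(* These exponent identities all restate [a * p + b * q = p * q + 1], except [eBB], which only uses
   [b <= p]. *)
have eA : 'X * 'X^(p * (q - a)) = 'X^(q * b) :> {poly int}.
  by rewrite -exprS; congr (_ ^+ _); rewrite mulnBr; nia.
have eB : 'X * 'X^(q * (p - b)) = 'X^(p * a) :> {poly int}.
  by rewrite -exprS; congr (_ ^+ _); rewrite mulnBr; nia.
have eAB : 'X^(p * a) * 'X^(q * b) = 'X * 'X^(p * q) :> {poly int}.
  by rewrite -exprS -exprD; congr (_ ^+ _); nia.
have eBB : 'X^(q * b) * 'X^(q * (p - b)) = 'X^(p * q) :> {poly int}.
  by rewrite -exprD -mulnDr subnKC // mulnC.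
transitivity ('X^(p * a) * 'X^(q * b) - 'X^(p * a) - 'X^(q * b) + 1
  - ('X * 'X^(p * (q - a)) * 'X^(q * (p - b)) - 'X * 'X^(p * (q - a))
     - 'X * 'X^(q * (p - b)) + 'X) : {poly int}); last by ring.
rewrite eA eB eAB eBB; ring.
Qed.

(** The splitting has [a * b] positive and [(q - a) * (p - b) = a * b - 1] negative monomials, so
    twice the sum is at most [4 * (a * b) - 2]. The means inequality for [a * p] and [b * q] bounds
    this by [p * q]. *)
Lemma Sn_mul_primes p q : prime p -> prime q -> p != q -> (2 * Sn (p * q) <= p * q)%N.
Proof.
move=> pp pq npq; have p1 := prime_gt1 pp; have q1 := prime_gt1 pq.
have cpq : coprime p q by rewrite prime_coprime // dvdn_prime2.
have [a aq ea] : exists2 a, (a < q)%N & (a * p %% q = 1)%N.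
  case: (egcdnP q (prime_gt0 pp)) => u v e _; exists (u %% q)%N.
    by rewrite ltn_mod ltnW.
  by rewrite modnMml e (eqP cpq) modnMDl modn_small.
(* Since [a * p] leaves remainder 1 mod [q], this is [(p * q + 1 - a * p) / q]. *)
pose b := (p - a * p %/ q)%N.
have hd := divn_eq (a * p) q; rewrite ea in hd.
have cp : (a * p %/ q < p)%N.
  by rewrite ltn_divLR ?(ltnW q1) // mulnC ltn_pmul2l // ltnW.
have eab : (a * p + b * q = p * q + 1)%N.
  by rewrite /b mulnBl {1}hd addnAC subnKC // leq_mul2r ltnW ?orbT.
have bp : (b <= p)%N by rewrite leq_subr.
have hS : (Sn (p * q) <= a * b + (q - a) * (p - b))%N.
  rewrite SnE (Phi_mul_primes pp pq npq (ltnW aq) bp eab).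
  rewrite (leq_trans (wnormD _ _ _)) // norm1N norm1XnM leq_add //.
    by rewrite (leq_trans (norm1M _ _)) // leq_mul ?norm1_geom.
  by rewrite (leq_trans (norm1M _ _)) // leq_mul ?norm1_geom.
have e2 : ((q - a) * (p - b) + 1 = a * b)%N.
  move: {hd ea} eab; move: b bp {cp hS} => b bp eab; nia.
(* With [N = p * q], the means inequality gives [4 * (a * b) * N <= (N + 1)^2]; a value of at least
   [N + 3] for [4 * (a * b)] would force [N <= 1]. *)
have h4 : (4 * (a * b) <= p * q + 2)%N.
  have [] := nat_AGM2 (a * p) (b * q); rewrite eab mulnACA => + _.
  have : (1 < p * q)%N by rewrite (leq_trans p1) // leq_pmulr // ltnW.
  move: (a * b)%N (p * q)%N => s N N1 h; rewrite leqNgt; apply/negP => h'.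
  have : ((N + 3) * N <= 4 * (s * N))%N by rewrite mulnA leq_mul2r; lia.
  move/leq_trans=> /(_ _ h); rewrite -mulnn mulnDl mulnDl mulnDr; lia.
lia.
Qed.

(** * The coefficients of the power series 1 / Phi_n *)

Lemma acoef0_sqr n : (0 < n)%N -> acoef n 0 * acoef n 0 = 1.
Proof.
move=> n0; have := congr1 (fun P : {poly int} => P`_0) (mul_coPhi n0).
rewrite coef0M coefB coefXn coef1 eqxx /= eq_sym gtn_eqF // /acoef.
move: ('Phi_n)`_0 (coPhi n)`_0 => x y /(congr1 absz) /eqP.
rewrite abszM sub0r muln_eq1 => /andP[/eqP x1 _].
by have [->|->] : x = 1 \/ x = -1 by lia.
Qed.

Lemma coef_periodize (P : {poly int}) n V s : (size P <= n)%N -> (s < n * V)%N ->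
  (P * \sum_(v < V) 'X^(n * v))`_s = P`_(s %% n).
Proof.
move=> hs sV; rewrite mulr_sumr coef_sum.
have n0 : (0 < n)%N by case: n sV {hs}.
have hv : (s %/ n < V)%N by rewrite ltn_divLR // mulnC.
rewrite (bigD1 (Ordinal hv)) //= big1 ?addr0 => [|i /eqP ne].
  rewrite coefMXn mulnC ltnNge leq_trunc_div /=; congr (P`_ _).
  by rewrite {1}(divn_eq s n) addKn.
have {}ne : nat_of_ord i <> (s %/ n)%N by move=> e; apply: ne; apply: val_inj.
rewrite coefMXn; case: ltnP => // h; rewrite nth_default // (leq_trans hs) //.
have lt : (i < s %/ n)%N.
  by rewrite ltn_neqAle leq_divRL // mulnC h andbT; apply/eqP.
by move: lt; rewrite leq_divRL // mulSn; lia.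
Qed.

(** This is [1 / Phi_n = - coPhi n / (1 - X^n)] read off at degree [t]. The geometric series is
    truncated to stay within polynomials; the error ['X^(n * t.+1)] lies beyond degree [t]. *)
Lemma Psi_conv n t : (0 < n)%N ->
  \sum_(i < t.+1) acoef n i * - (coPhi n)`_((t - i) %% n) = (t == 0%N)%:R.
Proof.
move=> n0; pose E : {poly int} := \sum_(v < t.+1) 'X^(n * v).
have e : 'Phi_n * (- coPhi n * E) = 1 - 'X^(n * t.+1).
  rewrite mulrA mulrN mul_coPhi // mulNr /E (eq_bigr (fun v : 'I__ => 'X^n ^+ v)).
    by rewrite -subrX1 opprB exprM.
  by move=> v _; rewrite exprM.
have := congr1 (fun P : {poly int} => P`_t) e.
rewrite coefM coefB coef1 coefXn (@ltn_eqF t (n * t.+1)) ?subr0 ?leq_pmull //.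
move=> <-; apply: eq_bigr => i _; congr (_ * _).
rewrite coef_periodize ?size_polyN ?size_coPhi ?coefN //.
by rewrite (leq_trans _ (leq_pmull _ n0)) // ltnS leq_subr.
Qed.

Lemma size_psi_seq n m : size (psi_seq n m) = m.+1.
Proof. by elim: m => //= m IH; rewrite size_rcons IH. Qed.

Lemma nth_psi_seq n m j : (j <= m)%N -> nth 0 (psi_seq n m) j = ccoef n j.
Proof.
elim: m => [|m IH]; first by rewrite leqn0 => /eqP ->.
rewrite leq_eqVlt => /predU1P[->//|]; rewrite ltnS => jm.
by rewrite /= nth_rcons size_psi_seq ltnS jm IH.
Qed.

(** [Psi_conv] shows that the periodic sequence obeys the recursion defining [psi_seq]; [acoef n 0]
    is its own inverse. *)
Lemma ccoefE n t : (0 < n)%N -> ccoef n t = - (coPhi n)`_(t %% n).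
Proof.
move=> n0; have a2 := acoef0_sqr n0.
elim/ltn_ind: t => -[|t] IH.
  have h : acoef n 0 * - (coPhi n)`_(0 %% n) = 1.
    by have := Psi_conv 0 n0; rewrite big_ord1.
  by rewrite /ccoef /= -[LHS]mulr1 -h mulrA a2 mul1r.
have := Psi_conv t.+1 n0; rewrite big_ord_recl /= subn0 => h.
rewrite /ccoef /= nth_rcons size_psi_seq ltnn eqxx.
rewrite big_add1 /= big_mkord.
rewrite (eq_bigr (fun i : 'I_t.+1 =>
    acoef n (lift ord0 i) * - (coPhi n)`_((t.+1 - lift ord0 i) %% n))).
  have -> := canRL (addKr _) h.
  by rewrite addr0 opprK mulrA a2 mul1r.
move=> i _; rewrite lift0 subSS nth_psi_seq ?leq_subr // IH //.
by rewrite ltnS leq_subr.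
Qed.

Local Close Scope ring_scope.

(** * Products of an increasing tuple of primes *)

Local Open Scope nat_scope.

Lemma odd_prime_tuple_take k n l : n <= k -> odd_prime_tuple k l ->
  odd_prime_tuple n (take n l).
Proof.
move=> nk /and3P[/eqP sl so /allP al]; apply/and3P; split.
- by rewrite size_take sl; case: ltngtP nk => // ->.
- exact: take_sorted.
- by apply/allP => x /mem_take /al.
Qed.

Lemma prodl_take1 l : 0 < size l -> prodl (take 1 l) = nth 0 l 0.
Proof. by case: l => //= a l _; rewrite take0 /prodl big_seq1. Qed.

Lemma prodl_takeS k l : k < size l -> prodl (take k.+1 l) = prodl (take k l) * nth 0 l k.
Proof. by move=> kl; rewrite (take_nth 0) // /prodl big_rcons. Qed.

(** On exponents this is [2 * (2^e - 1) + 1 = 2^(e+1) - 1]; the last prime enters with exponent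
    1. *)
Lemma Mk_rec k l : k <= size l ->
  Mk k.+2 l = Mk k.+1 l ^ 2 * prodl (take k l).
Proof.
move=> kl; have -> : prodl (take k l) = \prod_(j < k) nth 0 l j.
  elim: k kl => [|k IH] kl; first by rewrite take0 /prodl big_nil big_ord0.
  by rewrite prodl_takeS // big_ord_recr IH // ltnW.
case: k kl => [|k] kl; first by rewrite /Mk !big_ord0.
rewrite /Mk !subSS !subn0 !big_ord_recr /= (_ : k.+3 - k - 2 = 1) ?expn1; last by lia.
rewrite mulnA; congr (_ * _).
rewrite -mulnn -!big_split /=; apply: eq_bigr => j _ /=.
have -> : k.+3 - j - 2 = (k.+2 - j - 2).+1 by have := ltn_ord j; lia.
move: (k.+2 - j - 2) => e; rewrite -expnD -expnSr expnS; congr (_ ^ _).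
by have := expn_gt0 2 e; lia.
Qed.

(** * Bounds along the partial products of a tuple *)

Definition Sn_prod (l : seq nat) k := \prod_(1 <= j < k) Sn (prodl (take j l)).

Section Tuple.
Variables (n : nat) (l : seq nat).
Hypothesis hl : odd_prime_tuple n l.
Let P k := prodl (take k l).
Let V := Sn_prod l.

Lemma tuple_size : size l = n. Proof. by case/and3P: hl => /eqP. Qed.

Lemma tuple_prime k : k < n -> prime (nth 0 l k).
Proof.
case/and3P: hl => /eqP sl _ /allP al kn.
by have /andP[] : prime (nth 0 l k) && odd (nth 0 l k) by apply/al/mem_nth; rewrite sl.
Qed.

Lemma tuple_ndvd k : k < n -> ~~ (nth 0 l k %| P k).
Proof.
move=> kn; have pk := tuple_prime kn; have sl := tuple_size.
have ul : uniq l by case/and3P: hl => _ /sorted_uniq -> //; [exact: ltn_trans|exact: ltnn].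
(* The prefix length is separated from the position [k] of the prime, so that the induction runs
   over prefixes with the prime fixed. *)
rewrite /P; have := leqnn k; move: {1 4}k => j.
elim: j => [|j IH] jk; first by rewrite take0 /prodl big_nil dvdn1 neq_ltn prime_gt1 ?orbT.
have jn := ltn_trans jk kn; rewrite prodl_takeS ?sl // Euclid_dvdM // negb_or IH 1?ltnW //=.
by rewrite dvdn_prime2 ?tuple_prime // nth_uniq ?sl // neq_ltn jk orbT.
Qed.

Lemma tuple_prod_gt0 k : k <= n -> 0 < P k.
Proof.
elim: k => [|k IH] kn; first by rewrite /P take0 /prodl big_nil.
by rewrite /P prodl_takeS ?tuple_size // muln_gt0 IH ?prime_gt0 ?tuple_prime // ltnW.
Qed.

Lemma tuple_prod_gt1 k : 0 < k <= n -> 1 < P k.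
Proof.
case: k => // k kn; rewrite /P prodl_takeS ?tuple_size //.
by rewrite (leq_trans (prime_gt1 (tuple_prime kn))) // leq_pmull // tuple_prod_gt0 // ltnW.
Qed.

Lemma tuple_Ln k : 0 < k <= n -> Ln (P k) <= 2 * V k.
Proof.
case: k => // k; elim: k => [|k IH] kn.
  rewrite /V /Sn_prod big_geq // /P prodl_take1 ?tuple_size //.
  by rewrite muln1 Ln_prime ?tuple_prime.
rewrite /V /Sn_prod big_nat_recr //= -/(Sn_prod l k.+1) -/(V _) /P prodl_takeS ?tuple_size //.
rewrite (leq_trans (Ln_mul_prime _ (tuple_prime kn) (tuple_ndvd kn))) ?tuple_prod_gt0 ?(ltnW kn) //.
by rewrite mulnC mulnA leq_mul2r IH ?orbT //= ltnW.
Qed.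

(** The factor 2 gained in [An_mul_prime] cancels the 2 of [tuple_Ln]. *)
Lemma tuple_An k : 0 < k < n -> An (P k.+1) <= An (P k) * V k.
Proof.
move=> /andP[k0 kn]; have h := tuple_Ln (introT andP (conj k0 (ltnW kn))).
have P1 : 1 < P k by rewrite tuple_prod_gt1 // k0 ltnW.
have := An_mul_prime P1 (tuple_prime kn) (tuple_ndvd kn).
rewrite -prodl_takeS ?tuple_size // => /leq_trans/(_ (leq_mul (leqnn _) h)).
by rewrite mulnCA leq_pmul2l.
Qed.

Lemma tuple_ccoef k t : 0 < k < n ->
  `|ccoef (P k.+1) t| <= 2 * (An (P k) * V k).
Proof.
move=> /andP[k0 kn]; have h := tuple_Ln (introT andP (conj k0 (ltnW kn))).
rewrite ccoefE ?tuple_prod_gt0 // abszN /P prodl_takeS ?tuple_size //.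
rewrite (leq_trans (coPhi_coef_mul_prime _ _ (tuple_prime kn) (tuple_ndvd kn))) //.
  by rewrite tuple_prod_gt0 // ltnW.
by rewrite mulnCA leq_mul2l h orbT.
Qed.

Lemma tuple_Sn1 : 0 < n -> Sn (P 1) <= P 1.
Proof. by move=> n0; rewrite /P prodl_take1 ?tuple_size // Sn_prime ?tuple_prime. Qed.

Lemma tuple_Sn2 : 1 < n -> 2 * Sn (P 2) <= P 2.
Proof.
move=> n1; have n0 := ltnW n1; rewrite /P prodl_takeS ?tuple_size // prodl_take1 ?tuple_size //.
apply: Sn_mul_primes; rewrite ?tuple_prime //.
have := tuple_ndvd n1; rewrite /P prodl_take1 ?tuple_size // dvdn_prime2 ?tuple_prime //.
by rewrite eq_sym.
Qed.

(** Two steps of [tuple_An] leave the coefficient sum of the first prime. This a priori bound shows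
    that [eps 3] and [dconst] are not default values. *)
Lemma tuple_An3 : 2 < n -> An (P 3) <= Mk 3 l.
Proof.
move=> n2; have n1 := ltnW n2; have n0 := ltnW n1.
have h2 := @tuple_An 1 n1; rewrite /V /Sn_prod big_geq // in h2.
have h3 := @tuple_An 2 n2; rewrite /V /Sn_prod big_nat1 -/(P 1) in h3.
have h1 : An (P 1) <= 1 by rewrite /P prodl_take1 ?tuple_size // An_prime ?tuple_prime.
have m3 : Mk 3 l = P 1 by rewrite /Mk big_ord1 expn1 /P prodl_take1 ?tuple_size.
by have := tuple_Sn1 n0; rewrite m3; nia.
Qed.
End Tuple.

Open Scope R_scope.

(** * The constants *)

Lemma Rleast_spec (P : R -> Prop) :
  (exists e, P e /\ forall e', P e' -> e <= e') ->
  P (Rleast P) /\ forall e', P e' -> Rleast P <= e'.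
Proof.
move=> h; rewrite /Rleast; case: excluded_middle_informative => // h'.
exact: proj2_sig (constructive_indefinite_description _ h').
Qed.

Lemma Rdiv_leE a b c : 0 < b -> a / b <= c <-> a <= c * b.
Proof.
move=> b0; have e : a / b * b = a by rewrite /Rdiv Rmult_assoc Rinv_l; lra.
by split=> h; [rewrite -e; apply: Rmult_le_compat_r; lra|apply: (Rmult_le_reg_r b); lra].
Qed.

(** The supremum of [f t / g t] is the least admissible constant; it is finite by [B] and positive
    by [t0]. *)
Lemma Rleast_ratio_spec (T : Type) (D : T -> Prop) (f g : T -> R) B t0 :
    D t0 -> 0 < f t0 -> (forall t, D t -> 0 < g t) ->
    (forall t, D t -> f t <= B * g t) ->
  let P := fun e => 0 < e /\ forall t, D t -> f t <= e * g t in
  P (Rleast P) /\ forall e, P e -> Rleast P <= e.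
Proof.
move=> D0 f0 g0 hB P; apply: Rleast_spec.
have le e t : D t -> (f t / g t <= e <-> f t <= e * g t) by move/g0/Rdiv_leE.
have [] := completeness (fun x => exists t, D t /\ x = f t / g t).
- by exists B => x [t [Dt ->]]; apply/(le _ _ Dt); apply: hB.
- by exists (f t0 / g t0), t0.
move=> m [ub lub]; exists m; split; first split.
- apply: Rlt_le_trans (ub _ (ex_intro _ t0 (conj D0 erefl))).
  exact: Rdiv_lt_0_compat f0 (g0 _ D0).
- by move=> t Dt; apply/(le _ _ Dt); apply: ub; exists t.
- by move=> e [_ he]; apply: lub => x [t [Dt ->]]; apply/(le _ _ Dt); apply: he.
Qed.

Lemma Rsup_spec (P : R -> Prop) : (exists x, P x) -> bound P -> is_lub P (Rsup P).
Proof.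
move=> ne bd; rewrite /Rsup; case: excluded_middle_informative => [h|[]].
  exact: proj2_sig (constructive_indefinite_description _ h).
by have [m hm] := completeness P bd ne; exists m.
Qed.

Lemma Rlim_spec u : (exists l, Un_cv u l) -> Un_cv u (Rlim u).
Proof.
move=> h; rewrite /Rlim; case: excluded_middle_informative => // h'.
exact: proj2_sig (constructive_indefinite_description _ h').
Qed.

Lemma INR_leq a b : (a <= b)%N -> INR a <= INR b.
Proof. by move/leP; apply: le_INR. Qed.

Lemma INR_muln a b : INR (a * b)%N = INR a * INR b.
Proof. exact: mult_INR. Qed.

Lemma INR_gt0 a : (0 < a)%N -> 0 < INR a.
Proof. by move/ltP; apply: lt_0_INR. Qed.

Lemma INR_exp2n k : INR (2 ^ k)%N = 2 ^ k.
Proof. by elim: k => // k IH; rewrite expnS INR_muln IH. Qed.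

Lemma ln_ge_1_inv x : 0 < x -> 1 - / x <= ln x.
Proof.
move=> x0; have := exp_ineq1_le (- ln x); rewrite exp_Ropp exp_ln //; lra.
Qed.

(** * Existence and positivity of the constants *)

Lemma exists_odd_prime_tuple k : exists l, odd_prime_tuple k l.
Proof.
elim: k => [|k [l /and3P[/eqP sl so al]]]; first by exists [::].
(* Exceeding 2 makes [p] odd, exceeding the last entry keeps the tuple increasing. *)
have [p hp pp] := prime_above (2 + last 0%N l).
exists (rcons l p); rewrite /odd_prime_tuple size_rcons sl eqxx all_rcons al pp /= andbT.
apply/andP; split; last by case: (even_prime pp) hp => // ->; lia.
case: l so hp {sl al} => //= a l; rewrite rcons_path => -> /=; lia.
Qed.

Lemma Mk_gt0 k l n : odd_prime_tuple n l -> (k - 2 <= n)%N -> (0 < Mk k l)%N.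
Proof.
move=> hl kn; apply: prodn_gt0 => j; rewrite expn_gt0 prime_gt0 //.
by apply: (tuple_prime hl); apply: leq_trans kn.
Qed.

Lemma acoef0_gt0 n : (0 < n)%N -> (0 < `|acoef n 0|)%N.
Proof. by move=> n0; have := acoef0_sqr n0; case: (acoef n 0) => [[|m]|m]. Qed.

Lemma An_gt0 n : (0 < n)%N -> (0 < An n)%N.
Proof. by move=> n0; apply: leq_trans (acoef0_gt0 n0) (An_ge n 0). Qed.

Lemma Sn_gt0 n : (0 < n)%N -> (0 < Sn n)%N.
Proof.
move=> n0; have h : (0 < size 'Phi_n)%N by rewrite size_Cyclotomic.
by rewrite /Sn (bigD1 (Ordinal h)) //= addn_gt0 acoef0_gt0.
Qed.

Lemma Cn_spec n B : (0 < n)%N -> (forall t, INR `|ccoef n t|%N <= B) ->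
  0 < Cn n <= B.
Proof.
move=> n0 hB; have [] := @Rsup_spec (fun x => exists m : nat, x = INR `|ccoef n m|%N).
- by exists (INR `|ccoef n 0|%N), 0%N.
- by exists B => x [t ->].
rewrite -/(Cn n) => ub lub; split; last by apply: lub => x [t ->].
apply: Rlt_le_trans (ub _ (ex_intro _ 0%N erefl)).
by apply: INR_gt0; apply: acoef0_gt0.
Qed.

Lemma eps_spec k B :
    (forall l, odd_prime_tuple k l -> INR (An (prodl l)) <= B * INR (Mk k l)) ->
  (0 < eps k /\ forall l, odd_prime_tuple k l -> INR (An (prodl l)) <= eps k * INR (Mk k l)).
Proof.
move=> hB; have [l hl] := exists_odd_prime_tuple k.
have [] // := @Rleast_ratio_spec _ (odd_prime_tuple k) (fun l => INR (An (prodl l)))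
  (fun l => INR (Mk k l)) B l.
- apply/INR_gt0/An_gt0; have := tuple_prod_gt0 hl (leqnn k).
  by rewrite take_oversize // (tuple_size hl).
- by move=> t ht; apply/INR_gt0/(Mk_gt0 ht); rewrite leq_subr.
Qed.

Lemma eps3_spec : 0 < eps 3 /\
  forall l, odd_prime_tuple 3 l -> INR (An (prodl l)) <= eps 3 * INR (Mk 3 l).
Proof.
apply: (@eps_spec 3 1) => l hl; rewrite Rmult_1_l; apply: INR_leq.
by have := tuple_An3 hl (leqnn 3); rewrite take_oversize // (tuple_size hl).
Qed.

(** For the primes 3, 5, 7 the height is at least 1 and [Mk] is 3. *)
Lemma eps3_ge : / 3 <= eps 3.
Proof.
have [_ /(_ [:: 3; 5; 7]%N erefl)] := eps3_spec.
rewrite /Mk big_ord1 /prodl !big_cons big_nil.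
have /INR_leq : (0 < An (3 * (5 * (7 * 1))))%N by apply: An_gt0.
rewrite /=; lra.
Qed.

(** The ratios are bounded by 1: the sum for [p * q * r] is at most [p * q * r] times the height,
    which is at most [p]. *)
Lemma dconst_spec : 0 < dconst /\
  forall p q r, odd_prime_tuple 3 [:: p; q; r] ->
    INR (Sn (p * q * r)) <= dconst * (INR p ^ 2 * INR q * INR r).
Proof.
have h p q r : odd_prime_tuple 3 [:: p; q; r] -> [/\ 0 < INR (Sn (p * q * r)),
    0 < INR p ^ 2 * INR q * INR r & INR (Sn (p * q * r)) <= INR p ^ 2 * INR q * INR r].
  move=> hl; have P3 : prodl (take 3 [:: p; q; r]) = (p * q * r)%N.
    by rewrite /prodl /= !big_cons big_nil muln1 mulnA.
  have := tuple_prod_gt1 hl (isT : (0 < 3 <= 3)%N).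
  have /= p0 := prime_gt0 (tuple_prime hl (isT : (0 < 3)%N)).
  have /= q0 := prime_gt0 (tuple_prime hl (isT : (1 < 3)%N)).
  have /= r0 := prime_gt0 (tuple_prime hl (isT : (2 < 3)%N)).
  rewrite P3 => n1.
  have hA : (An (p * q * r) <= p)%N.
    by have := tuple_An3 hl (leqnn 3); rewrite P3 /Mk big_ord1 expn1.
  split.
  - exact/INR_gt0/Sn_gt0/ltnW.
  - have pos a b : 0 < a -> 0 < b -> 0 < a * b by exact: Rmult_lt_0_compat.
    by apply: (pos); [apply: (pos); [rewrite /= Rmult_1_r; apply: pos|]|]; exact: INR_gt0.
  have := INR_leq (leq_trans (Sn_leq n1) (leq_mul (leqnn _) hA)).
  by rewrite !INR_muln /=; lra.
have [l hl] := exists_odd_prime_tuple 3.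
have [] := @Rsup_spec (fun x => exists p q r : nat, odd_prime_tuple 3 [:: p; q; r] /\
          x = INR (Sn (p * q * r)) / (INR p ^ 2 * INR q * INR r)).
- case: l hl => [|p [|q [|r [|? ?]]]] // hl.
  by exists (INR (Sn (p * q * r)) / (INR p ^ 2 * INR q * INR r)), p, q, r.
- exists 1 => _ [p [q [r [hp ->]]]]; have [_ h1 h2] := h _ _ _ hp.
  by apply/(Rdiv_leE _ _ h1); lra.
rewrite -/dconst => ub _.
have le p q r : odd_prime_tuple 3 [:: p; q; r] ->
    INR (Sn (p * q * r)) <= dconst * (INR p ^ 2 * INR q * INR r).
  move=> hp; have [_ h1 _] := h _ _ _ hp.
  apply/(Rdiv_leE _ _ h1).
  by apply: ub; exists p, q, r.
split=> //; case: l hl => [|p [|q [|r [|? ?]]]] // hl.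
have [h1 h2 _] := h _ _ _ hl; have := le _ _ _ hl; nra.
Qed.

(** * A lower bound for rho *)

Lemma ln_le x y : 0 < x -> x <= y -> ln x <= ln y.
Proof. by move=> x0 [/(ln_increasing _ _ x0)|->]; lra. Qed.

(** Makes [big_ord_recr] available for [rho_partial]. *)
HB.instance Definition _ := Monoid.isLaw.Build R 1 Rmult
  (fun x y z => esym (Rmult_assoc x y z)) Rmult_1_l Rmult_1_r.

Lemma ln_rho_factor i :
  - (/ 5 * / 2 ^ i) <= ln (Rpower ((2 * INR i + 5) / (2 * INR i + 6)) (/ 2 ^ i)) <= 0.
Proof.
have i0 := pos_INR i; have p2 : 0 < / 2 ^ i by apply/Rinv_0_lt_compat/pow_lt; lra.
rewrite /Rpower ln_exp; set x := _ / _.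
have x0 : 0 < x by apply: Rdiv_lt_0_compat; lra.
have x1 : x <= 1 by apply/Rdiv_leE; lra.
have lx : ln x <= 0 by rewrite -ln_1; apply: ln_le.
have : - / 5 <= ln x.
  apply: Rle_trans (ln_ge_1_inv x0); rewrite /x Rinv_div.
  have : (2 * INR i + 6) / (2 * INR i + 5) <= 1 + / 5 by apply/Rdiv_leE; lra.
  lra.
by nra.
Qed.

(** Each factor contributes at least [- / 5 * / 2 ^ i] to the logarithm, and these terms sum to
    -2/5. The partial products decrease and stay positive, so [rho] is a true limit. *)
Lemma ln_rho_ge : - 2 / 5 <= ln rho.
Proof.
pose f i := Rpower ((2 * INR i + 5) / (2 * INR i + 6)) (/ 2 ^ i).
have f0 i : 0 < f i by exact: exp_pos.
have rhoS N : rho_partial N.+1 = rho_partial N * f N.+1.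
  by rewrite /rho_partial big_ord_recr.
have bd N : 0 < rho_partial N /\ - (2 / 5 * (1 - / 2 ^ N.+1)) <= ln (rho_partial N).
  elim: N => [|N [IH0 IH]].
    have -> : rho_partial 0 = f 0%N by rewrite /rho_partial big_ord_recr big_ord0 /= Rmult_1_l.
    split; first exact: f0.
    by have [] := ln_rho_factor 0; rewrite -/(f 0%N) -[2 ^ 0]/1 -[2 ^ 1]/(2 * 1); lra.
  rewrite rhoS; split; first exact: Rmult_lt_0_compat.
  rewrite ln_mult //; have [h _] := ln_rho_factor N.+1; rewrite -/(f _) in h.
  have e : / 2 ^ N.+1 = 2 * / 2 ^ N.+2.
    rewrite -[N.+2]/(S N.+1) -[2 ^ S N.+1]/(2 * 2 ^ N.+1) Rinv_mult; lra.
  move: h IH; rewrite e; lra.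
have dec : Un_decreasing rho_partial.
  move=> N; rewrite rhoS; have [h _] := bd N.
  have [_ h1] := ln_rho_factor N.+1; rewrite -/(f _) in h1.
  have : f N.+1 <= 1 by apply: Rnot_lt_le => /ln_increasing; rewrite ln_1; move/(_ Rlt_0_1); lra.
  by have := f0 N.+1; nra.
have lb N : exp (- 2 / 5) <= rho_partial N.
  have [h0 h] := bd N; rewrite -(exp_ln _ h0).
  have : 0 < / 2 ^ N.+1 by apply/Rinv_0_lt_compat/pow_lt; lra.
  move=> h2; have [|->] : - 2 / 5 < ln (rho_partial N) \/ - 2 / 5 = ln (rho_partial N) by lra.
    by move/exp_increasing; lra.
  lra.
have cv : Un_cv rho_partial rho.
  apply: Rlim_spec.
  have [|l hl] := decreasing_cv _ dec; last by exists l.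
  by exists 0 => _ [N ->]; rewrite /opp_seq; have [] := bd N; lra.
have le : exp (- 2 / 5) <= rho.
  apply: (Rle_cv_lim lb) cv.
  by move=> e e0; exists 0%N => k _; rewrite Rdist_eq.
by rewrite -[X in X <= _]ln_exp; apply: ln_le => //; apply: exp_pos.
Qed.

(** * The recursion *)

Section Recursion.
Variables (n : nat) (l : seq nat).
Hypothesis hl : odd_prime_tuple n l.
Let P k := prodl (take k l).

Let Mrec k : (k <= n)%N ->
  INR (Mk k.+2 l) = INR (Mk k.+1 l) * INR (Mk k.+1 l) * INR (P k).
Proof. by move=> kn; rewrite Mk_rec ?(tuple_size hl) // -mulnn !INR_muln. Qed.

Let Ale k : (0 < k < n)%N ->
  INR (An (P k.+1)) <= INR (An (P k)) * INR (Sn_prod l k).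
Proof. by move=> kn; rewrite -INR_muln; apply/INR_leq/(tuple_An hl). Qed.

Let Vrec k : (0 < k)%N -> INR (Sn_prod l k.+1) = INR (Sn_prod l k) * INR (Sn (P k)).
Proof. by move=> k0; rewrite /Sn_prod big_nat_recr //= INR_muln. Qed.

Let Sle k : (0 < k <= n)%N -> INR (Sn (P k)) <= INR (P k) * INR (An (P k)).
Proof. by move=> kn; rewrite -INR_muln; apply/INR_leq/Sn_leq/(tuple_prod_gt1 hl). Qed.

Let mul_le a b c d : 0 <= a -> 0 <= c -> a <= b -> c <= d -> a * c <= b * d.
Proof. by move=> *; apply: Rmult_le_compat. Qed.

(** The normalisations by [Mk] and by [Mk] times the previous partial product are chosen so that
    [Mk_rec] absorbs everything except the squaring of [x]. *)
Lemma height_step k x : (1 < k < n)%N -> 0 <= x ->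
  INR (An (P k)) <= x * INR (Mk k l) ->
  INR (Sn_prod l k) <= x * (INR (Mk k l) * INR (P k.-1)) ->
  INR (An (P k.+1)) <= x * x * INR (Mk k.+1 l) /\
  INR (Sn_prod l k.+1) <= x * x * (INR (Mk k.+1 l) * INR (P k)).
Proof.
case: k => [|k] // /andP[k1 kn] x0 hA hV.
have hk : (k <= n)%N by lia.
rewrite (Mrec hk); split.
  apply: Rle_trans (Ale _) _; first by lia.
  apply: Rle_trans (mul_le (pos_INR _) (pos_INR _) hA hV) _.
  by apply: Req_le; rewrite /=; lra.
rewrite Vrec //.
have hS : INR (Sn (P k.+1)) <= INR (P k.+1) * (x * INR (Mk k.+1 l)).
  apply: Rle_trans (Sle _) _; first by lia.
  by apply: Rmult_le_compat_l hA; apply: pos_INR.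
apply: Rle_trans (mul_le (pos_INR _) (pos_INR _) hV hS) _.
by apply: Req_le; rewrite /=; lra.
Qed.

Let alpha := eps 3 * dconst / 4.

(** At index 4 the two constants are [eps 3 / 2] and [dconst / 2]; at index 5 both become their
    product [alpha], and the squaring can start. Each half comes from [tuple_Sn2]. *)
Lemma height_base : (4 < n)%N ->
  INR (An (P 5)) <= alpha * INR (Mk 5 l) /\
  INR (Sn_prod l 5) <= alpha * (INR (Mk 5 l) * INR (P 4)).
Proof.
move=> n4; have [e0 he] := eps3_spec; have [d0 hd] := dconst_spec.
have [n3 n2 n1 n0] : [/\ 3 < n, 2 < n, 1 < n & 0 < n]%N by split; lia.
have h3 := odd_prime_tuple_take n2 hl.
have M3 : INR (Mk 3 l) = INR (P 1).
  by rewrite /Mk big_ord1 expn1 /P prodl_take1 ?(tuple_size hl).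
have A3 : INR (An (P 3)) <= eps 3 * INR (Mk 3 l).
  have := he _ h3; rewrite /Mk !big_ord1 nth_take //.
have S1 := INR_leq (tuple_Sn1 hl n0); rewrite -/(P 1) in S1.
have S2 := INR_leq (tuple_Sn2 hl n1); rewrite INR_muln -/(P 2) /= in S2.
have S3 : INR (Sn (P 3)) <= dconst * (INR (P 1) * INR (P 3)).
  have sl := tuple_size hl; rewrite /P.
  move: h3 sl; case: (l) => [|p [|q [|r l']]] /=; rewrite ?take0; try by [].
  move=> h3 _; rewrite /prodl !big_cons big_nil !muln1 mulnA.
  by have := hd _ _ _ h3; rewrite !INR_muln /= Rmult_1_r !Rmult_assoc.
have V2 : INR (Sn_prod l 2) <= INR (P 1) by rewrite /Sn_prod big_nat1.
have V3 : INR (Sn_prod l 3) <= INR (P 1) * (INR (P 2) / 2).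
  by rewrite Vrec //; apply: mul_le (pos_INR _) (pos_INR _) V2 _; lra.
have V4 : INR (Sn_prod l 4) <= INR (P 1) * (INR (P 2) / 2) * (dconst * (INR (P 1) * INR (P 3))).
  by rewrite Vrec //; apply: mul_le (pos_INR _) (pos_INR _) V3 S3.
have M4 : INR (Mk 4 l) = INR (P 1) * INR (P 1) * INR (P 2) by rewrite Mrec ?M3 // ltnW.
have M5 : INR (Mk 5 l) = INR (Mk 4 l) * INR (Mk 4 l) * INR (P 3) by rewrite Mrec // ltnW.
have A4 : INR (An (P 4)) <= eps 3 / 2 * INR (Mk 4 l).
  apply: Rle_trans (Ale _) _; first by lia.
  apply: Rle_trans (mul_le (pos_INR _) (pos_INR _) A3 V3) _.
  by apply: Req_le; rewrite M3 M4; lra.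
have S4 : INR (Sn (P 4)) <= INR (P 4) * (eps 3 / 2 * INR (Mk 4 l)).
  apply: Rle_trans (Sle _) _; first by lia.
  by apply: Rmult_le_compat_l A4; apply: pos_INR.
split.
  apply: Rle_trans (Ale _) _; first by lia.
  apply: Rle_trans (mul_le (pos_INR _) (pos_INR _) A4 V4) _.
  by apply: Req_le; rewrite M5 M4 /alpha; lra.
rewrite Vrec //; apply: Rle_trans (mul_le (pos_INR _) (pos_INR _) V4 S4) _.
by apply: Req_le; rewrite M5 M4 /alpha; lra.
Qed.

Lemma height_bound k : (4 + k < n)%N ->
  INR (An (P (5 + k))) <= alpha ^ (2 ^ k)%N * INR (Mk (5 + k) l) /\
  INR (Sn_prod l (5 + k)) <= alpha ^ (2 ^ k)%N * (INR (Mk (5 + k) l) * INR (P (4 + k))).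
Proof.
have a0 : 0 <= alpha by have [? _] := eps3_spec; have [? _] := dconst_spec; rewrite /alpha; nra.
elim: k => [|k IH] kn; first by rewrite expn0 pow_1; apply: height_base.
have /IH[hA hV] : (4 + k < n)%N by lia.
rewrite expnS mulSn mul1n pow_add.
by apply: (@height_step (5 + k)) => //; apply: pow_le.
Qed.

Lemma ccoef_bound k t : (5 + k < n)%N ->
  INR `|ccoef (P (6 + k)) t|%N <= 2 * alpha ^ (2 ^ k.+1)%N * INR (Mk (6 + k) l).
Proof.
move=> kn; have /height_bound[hA hV] : (4 + k < n)%N by lia.
have h := INR_leq (tuple_ccoef hl t (kn : (0 < 5 + k < n)%N)).
move: h; rewrite !INR_muln => /Rle_trans; apply.
rewrite Rmult_assoc; apply: Rmult_le_compat_l; first by rewrite /=; lra.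
apply: Rle_trans (mul_le (pos_INR _) (pos_INR _) hA hV) _.
rewrite expnS mulSn mul1n pow_add -[(6 + k)%N]/(4 + k).+2 (@Mrec (4 + k)); last by lia.
by rewrite -[(4 + k).+1]/(5 + k)%N; apply: Req_le; lra.
Qed.
End Recursion.

(** * Comparison with the constant C *)

Lemma eps_inv_bound k :
  0 < eps_inv (6 + k) <= 2 * (eps 3 * dconst / 4) ^ (2 ^ k.+1)%N.
Proof.
set a := _ * _ ^ _; set n := (6 + k)%N.
have a0 : 0 < a.
  have [e0 _] := eps3_spec; have [d0 _] := dconst_spec.
  by apply: Rmult_lt_0_compat; [lra|apply: pow_lt; nra].
have hC l : odd_prime_tuple n l -> 0 < Cn (prodl l) <= a * INR (Mk n l).
  move=> hl; have tl : take n l = l by rewrite take_oversize // (tuple_size hl).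
  have l0 := tuple_prod_gt0 hl (leqnn n); rewrite tl in l0.
  apply: Cn_spec => // t; rewrite -{1}tl; exact: (ccoef_bound hl t (leqnn (6 + k))).
have [l0 h0] := exists_odd_prime_tuple n.
have [] := @Rleast_ratio_spec _ (odd_prime_tuple n) (fun l => Cn (prodl l))
  (fun l => INR (Mk n l)) a l0.
- exact: h0.
- by have [] := hC _ h0.
- by move=> t ht; apply/INR_gt0/(Mk_gt0 ht); rewrite leq_subr.
- by move=> t /hC[].
rewrite -/(eps_inv n) => -[e0 _] /(_ a) h; split=> //; apply: h; split=> // l /hC[] //.
Qed.

(** With [2 ^ (6 + k) / 32 = 2 * 2 ^ k], the terms in [dconst] and [/ 4] cancel, leaving [ln 2] to
    be compared with [2 ^ k] times the right side of [D]. *)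
Lemma ln_le_Cconst k :
  ln (2 * (eps 3 * dconst / 4) ^ (2 ^ k.+1)%N) <= 2 ^ (6 + k) * ln Cconst.
Proof.
have [e0 _] := eps3_spec; have [d0 _] := dconst_spec; have lr := ln_rho_ge.
have e3 := eps3_ge.
have hp x y : 0 < Rpower x y by exact: exp_pos.
have lp x y : ln (Rpower x y) = y * ln x by rewrite /Rpower ln_exp.
have a0 : 0 < eps 3 * dconst / 4 by nra.
have m0 a b : 0 < a -> 0 < b -> 0 < a * b by exact: Rmult_lt_0_compat.
have lC : ln (3 / 4 * Rpower (eps 3) (3 / 2) * dconst * Rpower rho (/ 4)) =
    ln 3 + ln (/ 4) + 3 / 2 * ln (eps 3) + ln dconst + / 4 * ln rho.
  by rewrite -!lp /Rdiv !ln_mult //; do ?apply: (m0); try exact: hp; lra.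
have la : ln (eps 3 * dconst / 4) = ln (eps 3) + ln dconst + ln (/ 4).
  by rewrite /Rdiv !ln_mult //; [exact: m0|lra].
rewrite /Cconst lp lC ln_mult; [|lra|exact: pow_lt].
rewrite ln_pow // INR_exp2n la.
have l4 : ln (/ 4) = - (2 * ln 2).
  have e4 : 4 = 2 * 2 by lra.
  by rewrite ln_Rinv ?e4 ?ln_mult; lra.
have le : - ln 3 <= ln (eps 3) by rewrite -ln_Rinv; [apply: ln_le; lra|lra].
have l32 : / 3 <= ln 3 - ln 2.
  have h : 0 < 3 / 2 by lra.
  by have := ln_ge_1_inv h; rewrite Rinv_div /Rdiv ln_mult ?ln_Rinv; lra.
have l2 : 0 < ln 2 by rewrite -ln_1; apply: ln_increasing; lra.
have k0 : 1 <= 2 ^ k by apply: pow_R1_Rle; lra.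
(* By [eps3_ge] and [ln_rho_ge] the right side is at least [ln 3 - / 5], and [ln 3 - ln 2] is at
   least 1/3. *)
have D : ln 2 <= 2 * (ln 3 + / 2 * ln (eps 3) + / 4 * ln rho) by lra.
have := Rmult_le_compat _ _ _ _ Rle_0_1 (Rlt_le _ _ l2) k0 D.
have -> : 2 ^ (6 + k) = 64 * 2 ^ k by rewrite -[(6 + k)%N]/(6 + k)%coq_nat pow_add; lra.
by rewrite l4 /=; lra.
Qed.

Theorem theorem2 :
  exists delta : nat -> R,
    Un_cv delta 0 /\
    forall k : nat, (1 <= k)%nat ->
      0 < Cconst + delta k /\
      ln (eps_inv k) <= 2 ^ k * ln (Cconst + delta k).
Proof.
have C0 : 0 < Cconst by exact: exp_pos.
(* For the finitely many [k < 6] this makes [ln (Cconst + delta k)] at least the absolute value of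
   [ln (eps_inv k)], and [2 ^ k >= 1] does the rest. *)
exists (fun k => if (k < 6)%N then exp (Rabs (ln (eps_inv k))) else 0); split.
  move=> e e0; exists 6%N => k hk; rewrite ifF; last by apply/negbTE; rewrite -leqNgt; apply/leP.
  by rewrite /Rdist Rminus_0_r Rabs_R0.
move=> k _; case: ltnP => [k6|k6].
  set L := ln (eps_inv k); have E0 := exp_pos (Rabs L); split; first lra.
  have h : Rabs L <= ln (Cconst + exp (Rabs L)).
    by rewrite -[X in X <= _]ln_exp; apply: ln_le; lra.
  have k1 : 1 <= 2 ^ k by apply: pow_R1_Rle; lra.
  have := Rle_abs L; have := Rabs_pos L; nra.
rewrite Rplus_0_r; split=> //; have -> : k = (6 + (k - 6))%N by rewrite subnKC.
have [h1 h2] := eps_inv_bound (k - 6).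
by apply: Rle_trans (ln_le_Cconst _); apply: ln_le.
Qed.
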